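(* Let $X$ be a smooth projective toric variety with total coordinate ring $S$. For each $d\in\operatorname{Nef}X$, let $F_\bullet$ be the cellular complex of free $S$-modules associated to $d$ (defined in the context). Then the sheafification $\tilde F_\bullet(d)$ of the twist of $F_\bullet$ by $d$ (1) is (isomorphic, as a complex of sheaves on $X$, to) the output of the Fourier--Mukai transform of $\mathcal O(d)$ with respect to the resolution of the diagonal $\tilde G_\bullet$ of Hanlon, Hicks, and Lazarev; (2) contains only twists in the Bondal--Thomsen collection of $X$, i.e. every term of $\tilde F_\bullet(d)$ is a direct sum of line bundles belonging to the Bondal--Thomsen collection.
   Context: Toric setup. $X$ is a smooth projective toric variety over an algebraically closed field $k$, given by a fan of full dimension. $M$ is the character lattice, $N$ the lattice of one-parameter subgroups, $\langle\cdot,\cdot\rangle:M\times N\to\mathbb Z$ the pairing, and $u_1,\dots,u_r\in N$ the primitive ray generators. $S=k[x_1,\dots,x_r]$ is the total coordinate (Cox) ring, graded by $\operatorname{Pic}X$ with $\deg x_i$ the class of the torus-invariant divisor of $u_i$; $x^\alpha=\prod x_i^{\alpha_i}$ for $\alpha\in\mathbb Z^r$ (Laurent monomials allowed), and $\deg x^\alpha\in\operatorname{Pic}X$. Twists: $S(a)_b=S_{a+b}$. The exact sequence $0\to M\to\mathbb Z^r\to\operatorname{Pic}X\to0$ has first map $m\mapsto(\langle m,u_1\rangle,\dots,\langle m,u_r\rangle)$; via it $M$ and $M\otimes\mathbb R$ are identified with their images in $\mathbb Z^r$ and $\mathbb R^r$. Vector inequalities, $\lceil\cdot\rceil$, and $\lfloor\cdot\rfloor$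 are componentwise. $\operatorname{Nef}X\subset\operatorname{Pic}X$ is the set of nef classes. The complex $D$. Fix $d\in\operatorname{Nef}X$ and $\alpha\in\mathbb Z^r$ with $\deg x^\alpha=d$. Let $C$ be the cell structure on $\mathbb R^r$ whose codimension 1 skeleton is the union of the hyperplanes $\{\beta_i=n\}$, $1\le i\le r$, $n\in\mathbb Z$. Restricting $C$ to the affine space $\alpha+M\otimes\mathbb R$ gives a polyhedral cell structure whose (relatively) open cells are the nonempty intersections of open cells of $C$ with $\alpha+M\otimes\mathbb R$. $D$ is the (finite) subcomplex of those cells contained in $\mathbb R^r_{\ge0}$. Label a cell of $D$ by $x^{\lceil\beta\rceil}$ for any $\beta$ in its relative interior (independent of the choice of $\beta$). The complex $F_\bullet$. An incidence function $\varepsilon$ assigns to a cell $\sigma$ and a codimension 1 face $\tau$ of it a sign $\varepsilon(\sigma,\tau)\in\{\pm1\}$ (and $0$ for other pairs), as for the cellular chain complex of a regular cell complex (oriented boundary signs). Put $F_i=\bigoplus_{\dim\sigma=i}S(-\deg\ell_\sigma)e_\sigma$, the sum over cells $\sigma$ of $D$ of dimension $i$ with label $\ell_\sigma$, and $\partial e_\sigma=\sum_\tau\varepsilon(\sigma,\tau)\frac{\ell_\sigma}{\ell_\tau}e_\tau$, the sum over codimension 1 faces $\tau$ of $\sigma$. The Hanlon--Hicks--Lazarev resolution of the diagonal. Let $R=S\otimes_kS$ be the Cox ring of $X\times X$. Restrict $C$ to $M\otimes\mathbb R\subset\mathbb R^r$; this cell structure is invariant under translation by $M$; let $E$ be the quotient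 cell structure on the torus $(M\otimes\mathbb R)/M$. Use an incidence function $\varepsilon$ on the restriction of $C$ to $M\otimes\mathbb R$ invariant under simultaneous translation of pairs of cells by $M$; translation by $\alpha$ transports it to $D$, and this is the $\varepsilon$ used in $F_\bullet$. $G_j$ is the direct sum, over cells of $E$ of dimension $j$ (represented by a cell $\sigma$ of $M\otimes\mathbb R$ with interior point $\gamma$), of $S(\deg x^{\lfloor-\gamma\rfloor})\otimes_kS(\deg x^{\lfloor\gamma\rfloor})$, and the differential on the summand of $\sigma$ is the sum, over codimension 1 faces $\tau$ of $\sigma$ in $M\otimes\mathbb R$ with interior point $\delta$, of the maps to the summand of the image of $\tau$ in $E$ given by multiplication by $\varepsilon(\sigma,\tau)\,x^{\lceil\gamma\rceil-\lceil\delta\rceil}\otimes x^{\lfloor\delta\rfloor-\lfloor\gamma\rfloor}$. Its sheafification $\tilde G_\bullet$ is a resolution of the structure sheaf of the diagonal of $X\times X$ (Hanlon--Hicks--Lazarev). Fourier--Mukai transform. With $p,q:X\times X\to X$ the first and second projections, the Fourier--Mukai transform of $\mathcal O(d)$ with respect to $\tilde G_\bullet$ is $Rp_*(Lq^*\mathcal O(d)\otimes^L\tilde G_\bullet)$. For $d$ nef the spectral sequence computing it reduces to a single row, and the output of the transform means that row: the complex of sheaves $p_*(q^*\mathcal O(d)\otimes\tilde G_\bullet)$, with terms the direct sums over the cells of $E$ of $\mathcal O(\deg x^{\lfloor-\gamma\rfloor})\otimes_k\Gamma(X,\mathcal O(d+\deg x^{\lfloor\gamma\rfloor}))$ and differential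 induced by that of $G_\bullet$. Bondal--Thomsen collection. The set of line bundles $\mathcal O(\deg x^{\lfloor-\gamma\rfloor})$ on $X$ for $\gamma\in M\otimes\mathbb R\subset\mathbb R^r$. *)

(* Defs.v *)
From HB Require Import structures.
From mathcomp Require Import all_boot all_order all_algebra.
From mathcomp Require Import finmap.
From mathcomp.multinomials Require Import monalg.
From mathcomp Require Import boolp classical_sets functions cardinality fsbigop.
From mathcomp Require Import reals.

Set Implicit Arguments.
Unset Strict Implicit.
Unset Printing Implicit Defensive.

Import Order.TTheory GRing.Theory Num.Theory.
Local Open Scope ring_scope.
Local Open Scope quotient_scope.

(* M = N = Z^n as row vectors, with the standard dot product as pairing.
   A fan is given by the matrix whose rows are the ray generators u_i and by
   the sets of (indices of) rays that span its cones: a smooth fan is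
   simplicial, so these sets determine the cones and all their faces. *)

Definition cone_hull (R : realType) (n r : nat) (U : 'M[int]_(r, n))
    (s : {set 'I_r}) : set 'rV[R]_n :=
  [set x | exists c : 'rV[R]_r,
     [/\ forall i, 0 <= c 0 i,
         forall i, i \notin s -> c 0 i = 0 &
         x = c *m map_mx intr U]].

(* Fan of a smooth projective toric variety.  In [smooth_fan], the generators
   of each cone are part of a Z-basis of N (the rows of B).  The last field
   is the existence of an ample divisor sum_i a_i D_i: the fan is the normal
   fan of the lattice polytope {m | <m, u_i> >= - a_i}, the cone s being the
   one dual to the vertex m. *)
Record toric (R : realType) (n r : nat) := Toric {
  rays : 'M[int]_(r, n);
  cones : {set {set 'I_r}};
  ray_cone : forall i, [set i]%SET \in cones;
  face_cone : forall s t : {set 'I_r},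
    s \in cones -> t \subset s -> t \in cones;
  cone_meet : forall s t, s \in cones -> t \in cones ->
    (cone_hull rays s `&` cone_hull rays t
       `<=` (cone_hull rays (s :&: t)%SET : set 'rV[R]_n))%classic;
  smooth_fan : forall s, s \in cones ->
    exists (B : 'M[int]_n) (f : 'I_r -> 'I_n),
      [/\ B \in unitmx, {in s &, injective f} &
          {in s, forall i, row i rays = row (f i) B}];
  complete_fan : forall x : 'rV[R]_n,
    exists2 s, s \in cones & cone_hull rays s x;
  projective_fan : exists a : 'rV[int]_r,
    forall s, s \in cones -> #|s| = n -> exists m : 'rV[int]_n,
      forall i, - a 0 i <= (m *m rays^T) 0 i
                /\ ((m *m rays^T) 0 i == - a 0 i) = (i \in s)
}.

Section Picard.
Context (R : realType) (n r : nat) (X : toric R n r).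

(* The map M -> Z^r, and its extension to real coefficients. *)
Definition emb (m : 'rV[int]_n) : 'rV[int]_r := m *m (rays X)^T.
Definition embR (x : 'rV[R]_n) : 'rV[R]_r := x *m (map_mx intr (rays X))^T.

Definition principal : {pred 'rV[int]_r} :=
  fun a => `[< exists m, a = emb m >].

Lemma principal_zmod : zmod_closed principal.
Proof.
split=> [|a b /asboolP[m ->] /asboolP[m' ->]].
  by apply/asboolP; exists 0; rewrite /emb mul0mx.
by apply/asboolP; exists (m - m'); rewrite /emb mulmxBl.
Qed.

HB.instance Definition _ :=
  GRing.isZmodClosed.Build 'rV[int]_r principal principal_zmod.

Definition Pic : zmodType := @Quotient.quot 'rV[int]_r principal.
(* deg x^b *)
Definition mdeg (b : 'rV[int]_r) : Pic :=
  \pi_(@Quotient.quot 'rV[int]_r principal) b.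

End Picard.

(* K/k is a function field of one variable, i.e. the function field of a
   smooth projective curve over k. *)
Definition curve_field (k K : fieldType) (io : {rmorphism k -> K}) : Prop :=
  exists t : K,
    (forall p : {poly k}, root (map_poly io p) t -> p = 0) /\
    exists (N : nat) (e : 'I_N -> K), forall z : K,
      exists (q : {poly k}) (p : 'I_N -> {poly k}), q != 0 /\
        z * (map_poly io q).[t] = \sum_(i < N) (map_poly io (p i)).[t] * e i.

(* Normalized discrete valuations of K/k: the closed points of the curve.
   The junk value v 0 = 0 makes distinct functions distinct points. *)
Definition curve_point (k K : fieldType) (io : {rmorphism k -> K})
    (v : K -> int) : Prop :=
  [/\ v 0 = 0,
      forall x y, x != 0 -> y != 0 -> v (x * y) = v x + v y,
      forall x y, x != 0 -> y != 0 -> x + y != 0 ->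
        Num.min (v x) (v y) <= v (x + y),
      forall c, c != 0 -> v (io c) = 0 &
      exists x, v x = 1].

(* A morphism from the curve to X is the same as a K-point of X, and is given
   by homogeneous coordinates f in K^r whose vanishing coordinates lie in a
   common cone, up to the action of Hom(Pic X, K^* ).  At each point v of the
   curve this action can be used to make the coordinates integral with those
   vanishing at v in a common cone: [local_coord f v w] says that an element g
   of Hom(Pic X, K^* ) with v (g (deg x_i)) = w_i does so (w is a homomorphism
   Pic X -> Z as it kills M, i.e. sum_i w_i u_i = 0).  The w so obtained is
   unique, and the pullback of O(deg x^a) has degree sum_v sum_i w_i a_i,
   where w = 0 for almost all v. *)
Definition local_coord (R : realType) (n r : nat) (X : toric R n r)
    (K : fieldType) (f : 'I_r -> K) (v : K -> int) (w : 'rV[int]_r) : Prop :=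
  [/\ w *m rays X = 0,
      forall i, f i != 0 -> 0 <= v (f i) + w 0 i &
      [set i | (f i == 0) || (0 < v (f i) + w 0 i)]%SET \in cones X].

(* d is nef: it has nonnegative degree on every curve.  The points
   v_0, ..., v_{N-1} include all those contributing to the degree. *)
Definition nef (k : closedFieldType) (R : realType) (n r : nat)
    (X : toric R n r) (d : Pic X) : Prop :=
  forall (K : fieldType) (io : {rmorphism k -> K}) (f : 'I_r -> K),
    curve_field io ->
    [set i | f i == 0]%SET \in cones X ->
  forall (N : nat) (v : 'I_N -> K -> int) (w : 'I_N -> 'rV[int]_r),
    injective v ->
    (forall j, curve_point io (v j) /\ local_coord X f (v j) (w j)) ->
    (forall v', curve_point io v' -> (forall j, v' <> v j) ->
       local_coord X f v' 0) ->
  forall a : 'rV[int]_r, mdeg X a = d ->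
    0 <= \sum_(j < N) \sum_(i < r) w j 0 i * a 0 i.

Arguments nef k {R n r} X d.

(* What is used of a Cox ring: the group of Laurent monomials with its grading,
   the affine charts of the variety, indexed by the cones of the fan (faces
   giving smaller charts), and for each chart U the Laurent monomials that
   belong to the corresponding localization of the Cox ring. *)
Record cox := Cox {
  cexp : zmodType;
  cpic : zmodType;
  cdeg : cexp -> cpic;
  chart : Type;
  chart_face : chart -> chart -> Prop;  (* first argument is the larger *)
  creg : chart -> cexp -> Prop
}.

(* The chart of s is U_s, with Cox ring localized at prod_(i not in s) x_i. *)
Definition cox_toric (R : realType) (n r : nat) (X : toric R n r) : cox :=
  {| cexp := 'rV[int]_r;
     cpic := Pic X;
     cdeg := @mdeg R n r X;
     chart := {s : {set 'I_r} | s \in cones X};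
     chart_face := fun s t => val t \subset val s;
     creg := fun s b => forall i, i \in val s -> 0 <= b 0 i |}.

(* The product of two varieties: the Cox ring is the tensor product. *)
Definition cox_prod (A B : cox) : cox :=
  {| cexp := (cexp A * cexp B)%type;
     cpic := (cpic A * cpic B)%type;
     cdeg := fun b => (cdeg b.1, cdeg b.2);
     chart := (chart A * chart B)%type;
     chart_face := fun s t => chart_face s.1 t.1 /\ chart_face s.2 t.2;
     creg := fun s b => creg s.1 b.1 /\ creg s.2 b.2 |}.

(* The free module with basis (e_i), i : I, over the Laurent polynomial ring:
   the k-linear combinations of the x^b e_i, (i, b) : I * cexp A. *)
Notation lfree k A I := {malg k[(I * cexp A)%type]}.

(* c x^b e_i *)
Definition lmono (k : closedFieldType) (A : cox) (I : choiceType)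
    (c : k) (b : cexp A) (i : I) : lfree k A I := << c *g (i, b) >>.

(* A complex of graded free modules over the Cox ring S: in homological degree
   j it is the sum over i : gidx j of S(gdeg i) e_i, and gdiff i is the
   boundary of e_i. *)
Record gfree (k : closedFieldType) (A : cox) := GFree {
  gidx : nat -> choiceType;
  gdeg : forall j, gidx j -> cpic A;
  gdiff : forall j, gidx j.+1 -> lfree k A (gidx j)
}.

Definition gtwist (k : closedFieldType) (A : cox) (d : cpic A)
    (F : gfree k A) : gfree k A :=
  {| gidx := gidx F;
     gdeg := fun j i => gdeg i + d;
     gdiff := @gdiff k A F |}.

(* x^b s *)
Definition mshift (k : closedFieldType) (A : cox) (I : choiceType)
    (b : cexp A) (s : lfree k A I) : lfree k A I :=
  \sum_(p <- msupp s) lmono s@_p (b + p.2) p.1.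

(* A complex of quasi-coherent sheaves of k-vector spaces with an action of
   the structure sheaf, described on the affine charts.  All sheaves here are
   subsheaves of a constant sheaf [amb]: the sections over a chart form a
   subset of amb and restriction maps are inclusions.  The ring of functions
   on a chart U is spanned over k by the x^b with deg b = 0 and creg U b, so
   the module structure is given by the maps [smul b] for those b. *)
Record scomplex (k : closedFieldType) (A : cox) := SComplex {
  amb : nat -> lmodType k;
  sect : forall j, chart A -> set (amb j);
  smul : forall j, cexp A -> amb j -> amb j;
  sdiff : forall j, amb j.+1 -> amb j
}.

(* The sections over U of the sheaf associated to the sum of the S(a_i) are
   the elements of degree 0 in its localization; x^b e_i has degree
   deg b - a_i. *)
Definition sheafify (k : closedFieldType) (A : cox) (F : gfree k A) :
    scomplex k A :=
  {| amb := fun j => lfree k A (gidx F j);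
     sect := fun j U => [set s : lfree k A (gidx F j) |
       forall p, p \in msupp s -> cdeg p.2 = gdeg p.1 /\ creg U p.2]%classic;
     smul := fun j => @mshift k A (gidx F j);
     sdiff := fun j (s : lfree k A (gidx F j.+1)) =>
       \sum_(p <- msupp s) s@_p *: mshift p.2 (gdiff p.1) |}.

(* Direct image by the first projection: a section over U is a compatible
   family of sections over the charts U x V, i.e. one common section. *)
Definition pushforward1 (k : closedFieldType) (A B : cox)
    (H : scomplex k (cox_prod A B)) : scomplex k A :=
  {| amb := amb H;
     sect := fun j U => [set s : amb H j |
       forall V : chart B, @sect _ (cox_prod A B) H j (U, V) s]%classic;
     smul := fun j (b : cexp A) => @smul k (cox_prod A B) H j (b, 0);
     sdiff := @sdiff k _ H |}.

(* Isomorphism of complexes of sheaves of modules: isomorphisms on the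
   sections over each chart, k-linear and linear over the functions, and
   compatible with restrictions and differentials. *)
Definition scomplex_iso (k : closedFieldType) (A : cox)
    (P Q : scomplex k A) : Prop :=
  exists phi : forall j, chart A -> amb P j -> amb Q j,
  [/\ forall j U, set_bij (sect U) (sect U) (phi j U),
      forall j U (c : k) s t, @sect k A P j U s -> @sect k A P j U t ->
        phi j U (c *: s + t) = c *: phi j U s + phi j U t,
      forall j U (b : cexp A) s, cdeg b = 0 -> creg U b ->
        @sect k A P j U s -> phi j U (smul b s) = smul b (phi j U s),
      forall j U V s, chart_face U V -> @sect k A P j U s ->
        phi j V s = phi j U s &
      forall j U s, @sect k A P j.+1 U s ->
        phi j U (sdiff s) = sdiff (phi j.+1 U s)].

(* An open cell of the structure C on R^r is the set of all b with prescribed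
   floor(b) and ceil(b); it is encoded by this pair of vectors, so that if g
   is a point of the cell c then floor(g) = c.1, ceil(g) = c.2 and
   floor(-g) = - c.2. *)
Notation cell r := ('rV[int]_r * 'rV[int]_r)%type.

Definition cell_shift (r : nat) (a : 'rV[int]_r) (c : cell r) : cell r :=
  (a + c.1, a + c.2).

Section Cells.
Context (R : realType) (n r : nat) (X : toric R n r).

(* c meets a + M_R. *)
Definition is_cell (a : 'rV[int]_r) (c : cell r) : Prop :=
  exists x : 'rV[R]_n, let b := map_mx intr a + embR X x in
    c = (map_mx Num.floor b, map_mx Num.ceil b).

(* Dimension of the intersection of c with a + M_R when nonempty: it is open
   in an affine space directed by {x in M_R | <x, u_i> = 0 whenever the i-th
   coordinate is an integer on c}. *)
Definition cdim (c : cell r) : nat :=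
  let fixed : 'M[R]_(r, n) := \matrix_(i, l)
    if c.1 0 i == c.2 0 i then ((rays X) i l)%:~R else 0 in
  (n - \rank fixed)%N.

(* t is a codimension 1 face of s: points b of t satisfy s.1 <= b <= s.2. *)
Definition facet (s t : cell r) : Prop :=
  (forall i, s.1 0 i <= t.1 0 i /\ t.2 0 i <= s.2 0 i)
  /\ cdim s = (cdim t).+1.

(* Incidence functions on the cell structure of M_R; the last two conditions
   are that the boundary of the boundary of a cell is zero, and that the
   boundary of an edge is a difference of its end points. *)
Definition incidence (eps : cell r -> cell r -> int) : Prop :=
  [/\ forall s t, is_cell 0 s -> is_cell 0 t ->
        if `[< facet s t >] then eps s t = 1 \/ eps s t = -1
        else eps s t = 0,
      forall s t t' q, is_cell 0 s -> is_cell 0 t -> is_cell 0 t' ->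
        is_cell 0 q -> t <> t' ->
        facet s t -> facet s t' -> facet t q -> facet t' q ->
        eps s t * eps t q + eps s t' * eps t' q = 0 &
      forall s t t', is_cell 0 s -> is_cell 0 t -> is_cell 0 t' ->
        cdim s = 1%N -> t <> t' -> facet s t -> facet s t' ->
        eps s t + eps s t' = 0].

Definition invariant_incidence (eps : cell r -> cell r -> int) : Prop :=
  forall (m : 'rV[int]_n) s t, is_cell 0 s -> is_cell 0 t ->
    eps (cell_shift (emb X m) s) (cell_shift (emb X m) t) = eps s t.

(* The j-dimensional cells of D; a cell lies in the nonnegative orthant iff
   the floor of its points does. *)
Definition Dcell (a : 'rV[int]_r) (j : nat) : choiceType :=
  {c : cell r | `[< [/\ is_cell a c, cdim c = j & forall i, 0 <= c.1 0 i] >]}.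

Definition Fcomplex (k : closedFieldType) (a : 'rV[int]_r)
    (eps : cell r -> cell r -> int) : gfree k (cox_toric X) :=
  {| gidx := Dcell a : nat -> choiceType;
     gdeg := fun j (s : Dcell a j) => (- mdeg X (val s).2 : cpic (cox_toric X));
     gdiff := fun j (s : Dcell a j.+1) =>
       \sum_(t \in [set t : Dcell a j | facet (val s) (val t)]%classic)
         lmono (k := k) (A := cox_toric X)
           (eps (cell_shift (- a) (val s)) (cell_shift (- a) (val t)))%:~R
           ((val s).2 - (val t).2) t |}.

(* The j-dimensional cells of M_R and of the torus M_R / M. *)
Definition Mcell (j : nat) : choiceType :=
  {c : cell r | `[< is_cell 0 c /\ cdim c = j >]}.

Definition Mequiv (j : nat) : rel (Mcell j) := fun s t =>
  `[< exists m : 'rV[int]_n, val t = cell_shift (emb X m) (val s) >].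

Lemma Mequiv_equiv j : equiv_class_of (@Mequiv j).
Proof.
split=> [s|s t|t s q].
- apply/asboolP; exists 0.
  by rewrite /cell_shift /emb mul0mx !add0r -surjective_pairing.
- apply/asboolP/asboolP => -[m E]; exists (- m);
    by rewrite E /cell_shift /emb mulNmx !addrA !addNr !add0r
               -surjective_pairing.
- move=> /asboolP[m E] /asboolP[m' E']; apply/asboolP; exists (m' + m).
  by rewrite E' E /cell_shift /emb mulmxDl !addrA.
Qed.

Canonical Mequiv_rel j := EquivRelPack (@Mequiv_equiv j).

Definition Ecell (j : nat) : choiceType := {eq_quot @Mequiv j}.

(* The summand of e : Ecell j, and the differential on it, are computed with
   the representative [repr e]; the twist and the monomials do not depend on
   it.  Two faces t of [repr e] with the same image in E both contribute. *)
Definition Gcomplex (k : closedFieldType) (eps : cell r -> cell r -> int) :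
    gfree k (cox_prod (cox_toric X) (cox_toric X)) :=
  {| gidx := Ecell : nat -> choiceType;
     gdeg := fun j (e : Ecell j) => let s : Mcell j := repr e in
       ((mdeg X (- (val s).2), mdeg X (val s).1)
         : cpic (cox_prod (cox_toric X) (cox_toric X)));
     gdiff := fun j (e : Ecell j.+1) => let s : Mcell j.+1 := repr e in
       \sum_(t \in [set t : Mcell j | facet (val s) (val t)]%classic)
         lmono (k := k) (A := cox_prod (cox_toric X) (cox_toric X))
           (eps (val s) (val t))%:~R
           ((val s).2 - (val t).2, (val t).1 - (val s).1)
           (\pi_(Ecell j) t : Ecell j) |}.

End Cells.

Arguments Fcomplex {R n r} X k a eps.
Arguments Gcomplex {R n r} X k eps.

(* The complex p_*(q^*O(d) (x) G~): tensoring with q^*O(d) = O(0, d) is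
   twisting by (0, d). *)
Definition FM_output (k : closedFieldType) (R : realType) (n r : nat)
    (X : toric R n r) (d : Pic X) (eps : cell r -> cell r -> int) :
    scomplex k (cox_toric X) :=
  pushforward1 (sheafify (gtwist
    ((0, d) : cpic (cox_prod (cox_toric X) (cox_toric X)))
    (Gcomplex X k eps))).

Arguments FM_output k {R n r} X d eps.

(* The line bundle O(a) is represented by its class a. *)
Definition Bondal_Thomsen (R : realType) (n r : nat) (X : toric R n r) :
    set (Pic X) :=
  [set a | exists x : 'rV[R]_n,
     a = mdeg X (map_mx Num.floor (- embR X x))]%classic.
Arguments Bondal_Thomsen {R n r} X.

(* Main.v *)
(** Both complexes are spanned over [k] by monomials, so the isomorphism is the
    linear extension of a bijection of monomials.  It sends [x^b e_s], for a
    cell [s] of [D] with interior point [beta], to [x^b (x) x^floor(beta)] on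
    the summand of the class of [s - a] in [E].  Indeed a global section of
    [O(d + deg x^floor(g))] is spanned by monomials [x^(a + m + floor(g))] with
    nonnegative exponent and [m] in [M], and these correspond to the translates
    [a + m + g] contained in [D].  Monomial by monomial, the two differentials
    agree because a face of a cell of [D] is again in [D].  The first twist is
    unchanged: [d - deg x^ceil(a + g) = deg x^floor(-g)]. *)

From HB Require Import structures.
From mathcomp Require Import all_boot all_order all_algebra.
From mathcomp Require Import finmap.
From mathcomp.multinomials Require Import monalg.
From mathcomp Require Import boolp classical_sets functions fsbigop reals.
From mathcomp Require Import ring.
Require Import Defs.

Set Implicit Arguments.
Unset Strict Implicit.
Unset Printing Implicit Defensive.

Import Order.TTheory GRing.Theory Num.Theory.
Local Open Scope ring_scope.

(* Injectivity preserves the support, so that both sums have the junk value 0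
   when it is infinite. *)
Lemma raddf_fsbig_inj (V W : zmodType) (L : {additive V -> W}) (I : choiceType)
    (A : set I) (F : I -> V) : injective L ->
  L (\sum_(i \in A) F i) = \sum_(i \in A) L (F i).
Proof.
move=> injL; rewrite raddf_sum /finite_support !unlock.
suff -> : ((fun i => F i) @^-1` [set~ 0] =
           (fun i => L (F i)) @^-1` [set~ 0])%classic by [].
apply/seteqP; split=> i /= nz0 e0; apply: nz0; last by rewrite e0 raddf0.
by apply: injL; rewrite e0 raddf0.
Qed.

(** * Linear extension of maps defined on monomials *)

Section MalgLinear.
Context (k : comNzRingType) (K : choiceType).
Implicit Types (V : lmodType k) (s : {malg k[K]}).

(** Same sum as [sdiff] in [sheafify], so the differentials are instances of it by conversion. *)
Definition malg_lin V (h : K -> V) s : V := \sum_(p <- msupp s) s@_p *: h p.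

Lemma malg_linEw V (h : K -> V) s (D : {fset K}) : (msupp s `<=` D)%fset ->
  malg_lin h s = \sum_(p <- D) s@_p *: h p.
Proof.
move=> sD; rewrite /malg_lin (big_fset_incl _ sD) // => p _ /mcoeff_outdom ->.
by rewrite scale0r.
Qed.

Lemma malg_lin_is_linear V (h : K -> V) : linear (malg_lin h).
Proof.
move=> c s t; pose D := (msupp s `|` msupp t `|` msupp (c *: s + t))%fset.
rewrite !(@malg_linEw V h _ D);
  try by apply/fsubsetP=> p; rewrite !inE => ->; rewrite ?orbT.
rewrite scaler_sumr -big_split /=; apply: eq_bigr => p _.
by rewrite mcoeffD mcoeffZ scalerDl scalerA.
Qed.

HB.instance Definition _ V (h : K -> V) :=
  GRing.isLinear.Build k {malg k[K]} V *:%R (malg_lin h)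
    (malg_lin_is_linear h).

Lemma malg_linU V (h : K -> V) c p : malg_lin h << c *g p >> = c *: h p.
Proof. by rewrite (malg_linEw h msuppU_le) big_seq_fset1 mcoeffUU. Qed.

Lemma eq_malg_lin V (h h' : K -> V) s : h =1 h' -> malg_lin h s = malg_lin h' s.
Proof. by move=> e; apply: eq_bigr => p _; rewrite e. Qed.

Lemma linear_malg_lin V (W : lmodType k) (L : {linear V -> W}) (h : K -> V) s :
  L (malg_lin h s) = malg_lin (L \o h) s.
Proof. by rewrite linear_sum; apply: eq_bigr => p _; rewrite linearZ. Qed.

End MalgLinear.

(** * Linear maps induced by maps of monomials *)

Section MalgPush.
Context (k : comNzRingType) (K K' : choiceType) (f : K -> K').

Definition malg_push : {malg k[K]} -> {malg k[K']} :=
  malg_lin (fun p => << f p >>).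

HB.instance Definition _ := GRing.Linear.on malg_push.

Lemma malg_pushE s : malg_push s = \sum_(p <- msupp s) << s@_p *g f p >>.
Proof.
apply: eq_bigr => p _; apply/malgP => q.
by rewrite mcoeffZ !mcoeffU mulrnAr mulr1.
Qed.

Lemma malg_pushU c p : malg_push << c *g p >> = << c *g f p >>.
Proof.
by rewrite /malg_push malg_linU; apply/malgP => q;
  rewrite mcoeffZ !mcoeffU mulrnAr mulr1.
Qed.

Lemma malg_lin_push (V : lmodType k) (h : K' -> V) s :
  malg_lin h (malg_push s) = malg_lin (h \o f) s.
Proof.
by rewrite linear_malg_lin; apply: eq_malg_lin => p /=;
  rewrite malg_linU scale1r.
Qed.

Hypothesis finj : injective f.

(** Distinct monomials are never merged, so no coefficients add up. *)
Lemma mcoeff_push s p : (malg_push s)@_(f p) = s@_p.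
Proof.
rewrite malg_pushE [in RHS](monalgE s) !raddf_sum; apply: eq_bigr => q _ /=.
by rewrite !mcoeffU (inj_eq finj).
Qed.

Lemma malg_push_inj : injective malg_push.
Proof.
by move=> s t e; apply/malgP => p; rewrite -!mcoeff_push e.
Qed.

Lemma malg_push_fsbig (I : choiceType) (A : set I) (F : I -> {malg k[K]}) :
  malg_push (\sum_(i \in A) F i) = \sum_(i \in A) malg_push (F i).
Proof. exact/raddf_fsbig_inj/malg_push_inj. Qed.

(** Sections of the sheaves considered are cut out by a condition on the monomials of the support,
    so a bijection of the allowed monomials gives one of sections. Surjectivity lifts a combination
    term by term. *)
Lemma malg_push_bij (P : set K) (Q : set K') : set_bij P Q f ->
  set_bij [set s : {malg k[K]} | forall p, p \in msupp s -> P p]%classic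
          [set t : {malg k[K']} | forall q, q \in msupp t -> Q q]%classic malg_push.
Proof.
move=> [PQ _ fsurj]; split; last 1 first.
- move=> t Qt; rewrite [t]monalgE big_seq.
  elim/big_ind: _ => [|_ _ [s Ps <-] [s' Ps' <-]|q /Qt /fsurj [p Pp <-]].
  + by exists 0 => [p|]; [rewrite msupp0 | rewrite raddf0].
  + exists (s + s') => [p|]; last by rewrite raddfD.
    by move=> /(fsubsetP (msuppD_le _ _)); rewrite inE => /orP[/Ps|/Ps'].
  + exists << t@_(f p) *g p >>; last by rewrite malg_pushU.
    by move=> p' /(fsubsetP msuppU_le); rewrite inE => /eqP ->.
- move=> s Ps q; rewrite malg_pushE -mcoeff_neq0 raddf_sum => nz.
  have [[p ps /eqP <-]|no] := pselect (exists2 p, p \in msupp s & f p == q).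
    exact/PQ/Ps.
  case/eqP: nz; apply: big1_seq => p /andP[_ ps] /=; rewrite mcoeffU.
  by case: eqP => // fpq; case: no; exists p; rewrite ?fpq.
- by move=> s t _ _; exact: malg_push_inj.
Qed.

End MalgPush.

(** Turns multiplication by a monomial into a push, so that the lemmas above apply to it. *)
Lemma mshift_push (k : closedFieldType) (A : cox) (I : choiceType)
    (b : cexp A) (s : lfree k A I) :
  mshift b s = malg_push (fun p => (p.1, b + p.2)) s.
Proof. by rewrite malg_pushE. Qed.

Lemma pair_addl_inj (I : Type) (V : zmodType) (b : V) :
  injective (fun p : I * V => (p.1, b + p.2)).
Proof. by move=> [i p] [i' p'] /= [-> /addrI ->]. Qed.

(** * Translation of cells by integer vectors *)

Section CellShift.
Context (R : realType) (n r : nat) (X : toric R n r).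
Implicit Types (a b : 'rV[int]_r) (c : cell r) (m : 'rV[int]_n).

Lemma cell_shift0 c : cell_shift 0 c = c.
Proof. by rewrite /cell_shift !add0r -surjective_pairing. Qed.

Lemma cell_shiftD a b c : cell_shift (a + b) c = cell_shift a (cell_shift b c).
Proof. by rewrite /cell_shift /= !addrA. Qed.

Lemma cell_shiftK a : cancel (cell_shift a) (cell_shift (- a)).
Proof. by move=> c; rewrite -cell_shiftD addNr cell_shift0. Qed.

Lemma cell_shiftNK a : cancel (cell_shift (- a)) (cell_shift a).
Proof. by move=> c; rewrite -cell_shiftD subrr cell_shift0. Qed.

Lemma embN m : emb X (- m) = - emb X m.
Proof. exact: mulNmx. Qed.

Lemma map_intr_emb m : map_mx intr (emb X m) = embR X (map_mx intr m).
Proof. by rewrite /emb /embR map_mxM map_trmx. Qed.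

Lemma is_cell_shift a b c : is_cell X a c -> is_cell X (b + a) (cell_shift b c).
Proof.
move=> [x ->]; exists x; congr pair; apply/rowP => i; rewrite !mxE intrD.
  by rewrite -addrA [RHS]floorDzr ?intr_int // intrKfloor.
by rewrite -addrA [RHS]ceilDzr ?intr_int // intrKceil.
Qed.

(** A vector of [M] can be absorbed into the point of [M_R], so it leaves the affine space
    unchanged. *)
Lemma is_cell_emb a m c : is_cell X (emb X m + a) c -> is_cell X a c.
Proof.
move=> [x ->]; exists (map_mx intr m + x).
by rewrite map_mxD map_intr_emb /embR mulmxDl [_ *m _ + map_mx _ a]addrC addrA.
Qed.

Lemma cdim_shift a c : cdim X (cell_shift a c) = cdim X c.
Proof.
rewrite /cdim; congr (n - \rank _)%N; apply/matrixP => i l.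
by rewrite !mxE /= (inj_eq (addrI _)).
Qed.

Lemma facet_shift a c c' :
  facet X (cell_shift a c) (cell_shift a c') <-> facet X c c'.
Proof.
rewrite /facet !cdim_shift; split=> -[le_cc' ->]; split=> // i;
  by have := le_cc' i; rewrite !mxE !lerD2l.
Qed.

End CellShift.

(** * Cells of [D], of [M_R] and of the torus *)

Section CellMaps.
Context (R : realType) (n r : nat) (X : toric R n r) (a : 'rV[int]_r) (j : nat).

Lemma Mcell_of_subproof (s : Dcell X a j) :
  `[< is_cell X 0 (cell_shift (- a) (val s)) /\
      cdim X (cell_shift (- a) (val s)) = j >].
Proof.
case: s => c /= /asboolP[cell_c dim_c _]; apply/asboolP; rewrite cdim_shift.
by split=> //; rewrite -(addNr a); exact: is_cell_shift.
Qed.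

Definition Mcell_of (s : Dcell X a j) : Mcell X j :=
  exist (fun c => `[< is_cell X 0 c /\ cdim X c = j >]) _ (Mcell_of_subproof s).

Lemma Mcell_of_inj : injective Mcell_of.
Proof.
move=> s t [e1 e2].
by apply/val_inj/(can_inj (cell_shiftK (- a))); congr pair.
Qed.

(** The hypothesis puts the translate by [a] in the orthant, which is what a cell of [a + M_R] must
    satisfy to lie in [D]. *)
Lemma Mcell_of_surj (c : Mcell X j) : (forall i, 0 <= a 0 i + (val c).1 0 i) ->
  exists s, Mcell_of s = c.
Proof.
move=> c_ge0; have /asboolP[cell_c dim_c] := valP c.
have Ds : `[< [/\ is_cell X a (cell_shift a (val c)),
    cdim X (cell_shift a (val c)) = j &
    forall i, 0 <= (cell_shift a (val c)).1 0 i] >].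
  apply/asboolP; rewrite cdim_shift; split=> // [|i]; last by rewrite mxE.
  by have := is_cell_shift a cell_c; rewrite addr0.
exists (exist (fun c => `[< [/\ is_cell X a c, cdim X c = j &
  forall i, 0 <= c.1 0 i] >]) _ Ds).
by apply: val_inj; rewrite /= cell_shiftK.
Qed.

Lemma Mtrans_subproof (m : 'rV[int]_n) (c : Mcell X j) :
  `[< is_cell X 0 (cell_shift (emb X m) (val c)) /\
      cdim X (cell_shift (emb X m) (val c)) = j >].
Proof.
case: c => c /= /asboolP[cell_c dim_c]; apply/asboolP; rewrite cdim_shift.
by split=> //; apply: (@is_cell_emb _ _ _ _ _ m); exact: is_cell_shift.
Qed.

Definition Mtrans (m : 'rV[int]_n) (c : Mcell X j) : Mcell X j :=
  exist (fun c => `[< is_cell X 0 c /\ cdim X c = j >]) _ (Mtrans_subproof m c).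

Lemma MtransK m : cancel (Mtrans m) (Mtrans (- m)).
Proof. by move=> c; apply: val_inj; rewrite /= embN cell_shiftK. Qed.

Lemma MtransNK m : cancel (Mtrans (- m)) (Mtrans m).
Proof. by move=> c; apply: val_inj; rewrite /= embN cell_shiftNK. Qed.

Lemma pi_Mtrans m c : \pi_(Ecell X j)%qT (Mtrans m c) = \pi_(Ecell X j)%qT c.
Proof. by apply/esym/eqmodP/asboolP; exists m. Qed.

Lemma val_Mcell_ofP s m c : Mcell_of s = Mtrans m c ->
  val s = cell_shift a (cell_shift (emb X m) (val c)).
Proof. by move=> /(congr1 val) /= <-; rewrite cell_shiftNK. Qed.

Lemma repr_piE c :
  exists m, c = Mtrans m (repr (\pi_(Ecell X j)%qT c)).
Proof.
have /eqmodP/asboolP[m e] : (repr (\pi_(Ecell X j)%qT c) = c %[mod Ecell X j])%qT.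
  by rewrite reprK.
by exists m; apply: val_inj.
Qed.

End CellMaps.

(** * Degrees of Laurent monomials in [Pic X] *)

Section Degrees.
Context (R : realType) (n r : nat) (X : toric R n r).

Lemma mdeg_eqP (a b : 'rV[int]_r) :
  mdeg X a = mdeg X b <-> exists m, a = b + emb X m.
Proof.
rewrite /mdeg; split=> [/eqP|[m ->]].
  rewrite -Quotient.idealrBE => /asboolP[m e]; exists m.
  by rewrite -e addrC subrK.
by apply/eqP; rewrite -Quotient.idealrBE addrC addKr; apply/asboolP; exists m.
Qed.

Lemma mdegD : {morph mdeg X : a b / a + b}.
Proof. exact: raddfD. Qed.

Lemma mdegN : {morph mdeg X : a / - a}.
Proof. exact: raddfN. Qed.

Lemma mdeg_emb m : mdeg X (emb X m) = 0.
Proof. by rewrite -(raddf0 (mdeg X)); apply/mdeg_eqP; exists m; rewrite add0r. Qed.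

End Degrees.

(** * The bijection of monomials and its compatibility with the differentials *)

Section Comparison.
Context (k : closedFieldType) (R : realType) (n r : nat) (X : toric R n r).
Context (eps : cell r -> cell r -> int) (a : 'rV[int]_r).

Definition FM_monomial j (p : Dcell X a j * 'rV[int]_r) :
    Ecell X j * ('rV[int]_r * 'rV[int]_r) :=
  (\pi_(Ecell X j)%qT (Mcell_of p.1), (p.2, (val p.1).1)).

(** The class in the torus determines the cell only up to [M]; the recorded floor fixes the
    translate. *)
Lemma FM_monomial_inj j : injective (@FM_monomial j).
Proof.
move=> [s b] [t b'] /= [/eqmodP/asboolP[m e] -> floor_eq].
congr pair; apply: Mcell_of_inj; apply: val_inj; rewrite [RHS]e.
suff -> : emb X m = 0 by rewrite cell_shift0.
have /(congr1 fst) /= := e; rewrite floor_eq => /eqP.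
by rewrite -subr_eq subrr => /eqP.
Qed.

(** Degrees and regularity on [U] are read off from one chart [U x V], so some [V] must exist. *)
Lemma chart_inhabited : exists s : {s : {set 'I_r} | s \in cones X}, True.
Proof.
have [s Xs _] := complete_fan X 0.
by exists (exist (fun s => s \in cones X) s Xs).
Qed.

(** The charts of the rays force every exponent of the second factor to be nonnegative; conversely,
    nonnegative exponents are regular on every chart. *)
Lemma sect_FM_output (d : Pic X) j (U : chart (cox_toric X)) :
  @sect _ _ (FM_output k X d eps) j U =
  [set t : lfree k (cox_prod (cox_toric X) (cox_toric X)) (Ecell X j) |
   forall q, q \in msupp t ->
   [/\ mdeg X q.2.1 = mdeg X (- (val (repr q.1 : Mcell X j)).2),
       creg (c := cox_toric X) U q.2.1,
       mdeg X q.2.2 = mdeg X (val (repr q.1 : Mcell X j)).1 + d &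
       forall i, 0 <= q.2.2 0 i]]%classic.
Proof.
apply/seteqP; split=> t /= sect_t => [q qt|V q qt].
  have [V0 _] := chart_inhabited.
  have [[e1 e2] [/= Uq _]] := sect_t V0 q qt.
  split=> // [|i]; first by rewrite e1 addr0.
  have [_ [_ /= ge0]] := sect_t (exist (fun s => s \in cones X) _ (ray_cone X i)) q qt.
  by apply: ge0; rewrite inE.
have [e1 Uq e2 ge0] := sect_t q qt.
split; first by rewrite /= e1 e2; congr pair; rewrite /= ?addr0.
by split=> // i _; exact: ge0.
Qed.

Lemma FM_monomial_bij j (U : chart (cox_toric X)) :
  set_bij
    [set p : Dcell X a j * 'rV[int]_r |
      mdeg X p.2 = - mdeg X (val p.1).2 + mdeg X a
      /\ creg (c := cox_toric X) U p.2]%classic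
    [set q : Ecell X j * ('rV[int]_r * 'rV[int]_r) |
     [/\ mdeg X q.2.1 = mdeg X (- (val (repr q.1 : Mcell X j)).2),
         creg (c := cox_toric X) U q.2.1,
         mdeg X q.2.2 = mdeg X (val (repr q.1 : Mcell X j)).1 + mdeg X a &
         forall i, 0 <= q.2.2 0 i]]%classic
    (@FM_monomial j).
Proof.
split=> [[s b] /= [deg_b Ub]|x y _ _|[e [b b']] /= [deg_b Ub /esym]]; last first.
(* Equality of degrees gives [b' = a + floor(g) - m] for [g] in [repr e]. Hence the translate of
   [repr e] by [a - m] has floor [b'], and [b' >= 0] puts it in [D]. *)
- rewrite -mdegD => /mdeg_eqP[m eb'] b'_ge0; pose c := Mtrans (- m) (repr e).
  have b'E : b' = a + (val c).1.
    by rewrite /= embN addrCA [a + _]addrC eb' addrC addrK.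
  have [|s sc] := @Mcell_of_surj _ _ _ X a j c.
    by move=> i; have := b'_ge0 i; rewrite b'E mxE.
  have es : \pi_(Ecell X j)%qT (Mcell_of s) = e by rewrite sc pi_Mtrans reprK.
  have val_s : val s = cell_shift a (val c).
    by rewrite -sc /= cell_shiftNK.
  exists (s, b); last first.
    rewrite /FM_monomial /= es; congr (_, (_, _)).
    by rewrite val_s b'E.
  split=> //=; rewrite deg_b val_s /= embN mdegN !mdegD mdegN mdeg_emb oppr0.
  by rewrite add0r opprD addrAC addNr add0r.
- exact: FM_monomial_inj.
- have [m] := repr_piE (Mcell_of s); set c := repr _ => e.
  have /(congr1 val)/(congr1 (cell_shift a)) := e.
  rewrite [in X in X -> _]/= cell_shiftNK => val_s.
  have /asboolP[_ _ s_ge0] := valP s.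
  split=> //.
    rewrite deg_b val_s /= mdegN !mdegD mdeg_emb add0r.
    by rewrite opprD addrAC addNr add0r.
  by rewrite val_s /= !mdegD mdeg_emb add0r addrC.
Qed.

Hypothesis eps_inv : invariant_incidence X eps.

Lemma facet_Mtrans j m (c : Mcell X j.+1) (c' : Mcell X j) :
  facet X (val (Mtrans m c)) (val (Mtrans m c')) <-> facet X (val c) (val c').
Proof. exact: facet_shift. Qed.

(** The floor of a facet is at least that of the cell, so facets of a cell of [D] stay in [D] and
    every facet of [c] is reached. *)
Lemma facets_Mcell_of_bij j m (s : Dcell X a j.+1) (c : Mcell X j.+1) :
  Mcell_of s = Mtrans m c ->
  set_bij [set t : Dcell X a j | facet X (val s) (val t)]%classic
          [set u : Mcell X j | facet X (val c) (val u)]%classic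
          (fun t => Mtrans (- m) (Mcell_of t)).
Proof.
move=> sc; have facetE (t : Dcell X a j) :
    facet X (val s) (val t) <-> facet X (val c) (val (Mtrans (- m) (Mcell_of t))).
  rewrite -(facet_Mtrans m) MtransNK -sc.
  exact: iff_sym (facet_shift X (- a) (val s) (val t)).
split=> [t /= /facetE //|t t' _ _|u /= cu].
  by move=> /(can_inj (MtransNK m)) /Mcell_of_inj.
have [i|t tu] := @Mcell_of_surj _ _ _ X a j (Mtrans m u).
  have /asboolP[_ _ s_ge0] := valP s.
  have val_s := val_Mcell_ofP sc.
  apply: (le_trans (s_ge0 i)); rewrite val_s !mxE !lerD2l.
  by have [/(_ i)[]] := cu.
by exists t; [apply/facetE; rewrite tu MtransK | rewrite tu MtransK].
Qed.

(** The terms match facet by facet: the signs agree by invariance under [M], and the second exponent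
    telescopes, [floor(s) + (floor(t) - floor(s)) = floor(t)], as [FM_monomial] prescribes for
    [t]. *)
Lemma FM_monomial_diff j (s : Dcell X a j.+1) (b : 'rV[int]_r) :
  malg_push (@FM_monomial j)
    (mshift (A := cox_toric X) b (gdiff (g := Fcomplex X k a eps) s)) =
  mshift (A := cox_prod (cox_toric X) (cox_toric X)) (b, (val s).1)
    (gdiff (g := Gcomplex X k eps) (\pi_(Ecell X j.+1)%qT (Mcell_of s))).
Proof.
have [m] := repr_piE (Mcell_of s); rewrite /=; set c := repr _ => sc.
have cs_shift (t : Dcell X a j) : eps (val c) (val (Mtrans (- m) (Mcell_of t))) =
    eps (cell_shift (- a) (val s)) (cell_shift (- a) (val t)).
  have /asboolP[cell_c _] := valP c.
  have /asboolP[cell_t _] := valP (Mtrans (- m) (Mcell_of t)).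
  have /(congr1 val) /= -> := sc.
  by rewrite -(eps_inv m cell_c cell_t) /= embN cell_shiftNK.
have val_s := val_Mcell_ofP sc.
rewrite !mshift_push.
(* All the maps of monomials involved are injective, which lets the pushes pass through the sums
   over facets. *)
rewrite !(malg_push_fsbig (@pair_addl_inj _ _ _)) malg_push_fsbig;
  last exact: FM_monomial_inj.
rewrite (reindex_fsbig _ _ _ _ (facets_Mcell_of_bij sc)); apply: eq_fsbigr => t _.
rewrite /lmono !malg_pushU {}cs_shift.
have key : @FM_monomial j (t, b + ((val s).2 - (val t).2)) =
    (\pi_(Ecell X j)%qT (Mtrans (- m) (Mcell_of t)),
     (b + ((val c).2 - (val (Mtrans (- m) (Mcell_of t))).2),
      (val s).1 + ((val (Mtrans (- m) (Mcell_of t))).1 - (val c).1))).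
  rewrite /FM_monomial pi_Mtrans /= embN val_s; congr (_, (_, _)).
    by apply/rowP => i; rewrite !mxE; ring.
  by apply/rowP => i; rewrite !mxE; ring.
exact: (congr1 (fun q => << _ *g q >>) key).
Qed.
End Comparison.

Theorem mainTheorem2 (k : closedFieldType) (R : realType) (n r : nat)
    (X : toric R n r)
    (eps : cell r -> cell r -> int)
    (heps : incidence X eps) (hinv : invariant_incidence X eps)
    (d : Pic X) (hd : nef k X d)
    (a : 'rV[int]_r) (ha : mdeg X a = d) :
  let Fd : gfree k (cox_toric X) :=
    gtwist (d : cpic (cox_toric X)) (Fcomplex X k a eps) in
  scomplex_iso (sheafify Fd) (FM_output k X d eps)
  /\ (forall (j : nat) (s : gidx Fd j), Bondal_Thomsen X (gdeg s)).
Proof.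
case: _ / ha hd => _ Fd; split; last first.
  (* The point [x] of [M_R] that makes [s] a cell is also the witness here:
     [a - ceil(a + x) = - ceil(x) = floor(- x)]. *)
  move=> j s; have /asboolP[[x e] _ _] := valP s.
  exists x; rewrite /= -mdegN -mdegD e /=; congr mdeg.
  apply/rowP => i; rewrite !mxE ceilDzr ?intr_int // intrKceil.
  by rewrite ceilNfloor opprD opprK addrAC addNr add0r.
(* One map serves all charts, so compatibility with restrictions is immediate. *)
exists (fun j _ => malg_push (@FM_monomial R n r X a j)); split.
- move=> j U; rewrite sect_FM_output.
  exact: (malg_push_bij k (@FM_monomial_inj R n r X a j) (FM_monomial_bij a j U)).
- by move=> j U c s t _ _; rewrite linearP.
(* Functions of the first factor have second exponent 0, so they leave the recorded floor
   unchanged. *)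
- move=> j U b s _ _ _; rewrite /= !mshift_push.
  rewrite /malg_push !malg_lin_push.
  apply: eq_malg_lin => -[p q] /=.
  have key : FM_monomial (p, b + q) =
      (\pi_(Ecell X j)%qT (Mcell_of p), (b + q, 0 + (val p).1)) by rewrite add0r.
  exact: (congr1 (fun x => << x >>) key).
- by [].
- move=> j U s _.
  (* Both composites are linear extensions from monomials, so they are compared on a single
     monomial. *)
  pose hF (p : Dcell X a j.+1 * cexp (cox_toric X)) :=
    mshift p.2 (gdiff (g := Fcomplex X k a eps) p.1).
  pose hG (q : Ecell X j.+1 * cexp (cox_prod (cox_toric X) (cox_toric X))) :=
    mshift q.2 (gdiff (g := Gcomplex X k eps) q.1).
  apply: (etrans (linear_malg_lin (malg_push (@FM_monomial R n r X a j)) hF s)).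
  apply: (etrans _ (esym (malg_lin_push (@FM_monomial R n r X a j.+1) hG s))).
  by apply: eq_malg_lin => -[p b]; exact: FM_monomial_diff.
Qed.
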